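(* Let $t,\ell,k,d$ be positive integers. Let $G$ be a subgraph of $H\boxtimes P\boxtimes K_\ell$, for some graph $H$ of treewidth at most $t$ and some path $P$. Let $\mathcal{P}$ be a $(k,d)$-shortcut system for $G$. Then $G^{\mathcal{P}}$ is a subgraph of $J\boxtimes P'\boxtimes K_{d\ell(k^3+3k)}$ for some graph $J$ of treewidth at most $\binom{k+t}{t}-1$ and some path $P'$.
   Context: All graphs are finite and simple. A path of length $m$ has $m$ edges; a path is non-trivial if it has length at least 1. A non-empty set $\mathcal{P}$ of non-trivial paths in a graph $G$ is a $(k,d)$-shortcut system for $G$ if every path in $\mathcal{P}$ has length at most $k$, and for every $v\in V(G)$ the number of paths in $\mathcal{P}$ that contain $v$ as an internal vertex is at most $d$. For such $\mathcal{P}$, $G^{\mathcal{P}}$ is the supergraph of $G$ obtained by adding the edge $vw$ for each path in $\mathcal{P}$ with endpoints $v$ and $w$. The strong product $A\boxtimes B$ has vertex set $V(A)\times V(B)$, with distinct $(v,x),(w,y)$ adjacent if ($v=w$ and $xy\in E(B)$), or ($x=y$ and $vw\in E(A)$), or ($vw\in E(A)$ and $xy\in E(B)$). $K_m$ is the complete graph on $m$ vertices. *)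

(* Defs.v *)
(* Graphs: finite simple graphs given as a symmetric,
   irreflexive boolean relation on a finType. *)
From mathcomp Require Import all_boot.
Set Implicit Arguments. Unset Strict Implicit. Unset Printing Implicit Defensive.

Definition subgraph (V W : finType) (g : rel V) (x : rel W) : Prop :=
  exists f : V -> W, injective f /\ forall u v, g u v -> x (f u) (f v).

Definition strong (A B : finType) (a : rel A) (b : rel B) : rel (A * B)%type :=
  fun p q => [&& p != q, (p.1 == q.1) || a p.1 q.1 & (p.2 == q.2) || b p.2 q.2].

Definition path_rel (n : nat) : rel 'I_n :=
  fun i j => (i.+1 == j :> nat) || (j.+1 == i :> nat).

Definition complete (m : nat) : rel 'I_m := fun i j => i != j.

(* A tree: a nonempty connected simple graph with |E| = |V| - 1
   (edges counted as ordered pairs, hence the factor 2). *)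
Definition is_tree (T : finType) (e : rel T) : Prop :=
  [/\ symmetric e, irreflexive e, 0 < #|T|,
      forall x y, connect e x y
    & #|[set p : T * T | e p.1 p.2]| = 2 * (#|T| - 1)].

Definition treewidth_le (V : finType) (g : rel V) (w : nat) : Prop :=
  exists (T : finType) (e : rel T) (B : T -> {set V}),
    [/\ is_tree e,
        forall v, exists x, v \in B x,
        forall u v, g u v -> exists x, (u \in B x) && (v \in B x),
        forall v x y, v \in B x -> v \in B y ->
          connect [rel a b | [&& e a b, v \in B a & v \in B b]] x y
      & forall x, #|B x| <= w.+1].

(* A path in g, as its sequence of vertices: distinct vertices, consecutive
   ones adjacent. Its length is size p - 1. *)
Definition is_gpath (V : finType) (g : rel V) (p : seq V) : Prop :=
  [/\ 0 < size p, uniq p & forall i, i.+1 < size p -> forall x0,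
        g (nth x0 p i) (nth x0 p i.+1)].

Definition internal (V : finType) (p : seq V) (v : V) : bool :=
  v \in drop 1 (take (size p).-1 p).

(* A (k,d)-shortcut system: a non-empty set (list without repetitions, a path
   and its reversal being the same path) of non-trivial paths of length <= k,
   each vertex internal to at most d of them. *)
Definition shortcut_system (V : finType) (g : rel V) (k d : nat)
    (P : seq (seq V)) : Prop :=
  [/\ P != [::],
      pairwise (fun p q => (p != q) && (p != rev q)) P,
      forall p, p \in P -> is_gpath g p /\ 1 <= (size p).-1 <= k
    & forall v, count (fun p => internal p v) P <= d].

Definition augment (V : finType) (g : rel V) (P : seq (seq V)) : rel V :=
  fun x y => g x y ||
    ((x != y) && has (fun p => ((head x p == x) && (last x p == y)) ||
                               ((head x p == y) && (last x p == x))) P).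
Arguments path_rel n : clear implicits.
Arguments complete m : clear implicits.

(* Main.v *)
(** Work in a perfect elimination order of a chordal completion of [H], where
    [B x] is the set of earlier neighbours of [x] and [reach B k x] the set of
    vertices reached from [x] by at most [k] steps [y -> b] with [b \in B y].
    These sets have at most 'C(k + t, t) elements and again form an elimination
    order, so joining [x] to the elements of [reach B k x] gives a graph [J] of
    treewidth at most 'C(k + t, t) - 1. A vertex [v] of [G] goes to the earliest
    vertex [a v] of [H] among the projections of [v] and of the internal vertices
    of the paths of [P] through [v], and to the block of [k] consecutive layers
    that contains it. The ends of a path of [P] then have equal or [J]-adjacent
    images. Since each vertex is internal to at most [d] paths, at most
    [k * l + (3 * k - 2) * l * d * (k + 1) <= d * l * (k ^ 3 + 3 * k)] vertices
    share the same image. *)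
Require Import Defs.
From mathcomp Require Import all_boot.
From mathcomp Require Import zify.
Set Implicit Arguments. Unset Strict Implicit. Unset Printing Implicit Defensive.

(** * Elimination orders and the size of reachable sets *)

Definition elim_order (H : finType) (rk : H -> nat) (B : H -> {set H}) : Prop :=
  [/\ injective rk, forall y b, b \in B y -> rk b < rk y
    & forall y b c, b \in B y -> c \in B y -> rk c < rk b -> c \in B b].

Fixpoint reach (H : finType) (B : H -> {set H}) n x : {set H} :=
  if n is m.+1 then x |: \bigcup_(b in B x) reach B m b else [set x].

Section Reach.
Variables (H : finType) (rk : H -> nat) (B : H -> {set H}).

Lemma reach_refl n x : x \in reach B n x.
Proof. by case: n => [|n] /=; rewrite !inE eqxx. Qed.

Lemma reachSP n x a :
  reflect (a = x \/ exists2 b, b \in B x & a \in reach B n b)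
    (a \in reach B n.+1 x).
Proof.
rewrite /= !inE; apply: (iffP orP) => [[/eqP->|/bigcupP[b]]|[->|[b bx ab]]].
- by left.
- by right; exists b.
- by left.
- by right; apply/bigcupP; exists b.
Qed.

Lemma reachS n x b a : b \in B x -> a \in reach B n b -> a \in reach B n.+1 x.
Proof. by move=> bx ab; apply/reachSP; right; exists b. Qed.

Lemma reach_leq m n x a : m <= n -> a \in reach B m x -> a \in reach B n x.
Proof.
elim: m n x => [|m IH] [|n] x //.
  by move=> _; rewrite inE => /eqP->; exact: reach_refl.
move=> le_mn /reachSP[->|[b bx ab]]; first exact: reach_refl.
by apply: (reachS bx); exact: IH ab.
Qed.

Hypothesis eB : elim_order rk B.

Lemma reach_rk n x a : a \in reach B n x -> rk a <= rk x.
Proof.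
case: eB => _ ltB _; elim: n x => [|n IH] x; first by rewrite inE => /eqP->.
case/reachSP=> [->//|[b /ltB bx /IH ab]].
exact: leq_trans ab (ltnW bx).
Qed.

(** Let [c] be the first vertex after [x] on the walk to [a]. If [c] is earlier than [b], then
    [c \in B b] and the same step can start at [b]. If [c] is later, then [b \in B c] and the
    induction continues from [c]. *)
Lemma reach_cross1 j x b a :
  b \in B x -> a \in reach B j x -> rk a <= rk b -> a \in reach B j b.
Proof.
case: (eB) => injrk ltB trB.
elim: j x => [|j IH] x bx.
  by rewrite inE => /eqP-> le; have := ltB _ _ bx; rewrite ltnNge le.
case/reachSP=> [->|[c cx ac]] le.
  by have := ltB _ _ bx; rewrite ltnNge le.
case: (ltngtP (rk c) (rk b)) => [cb|bc|/injrk cb].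
- exact: reachS (trB _ _ _ bx cx cb) ac.
- by apply: (@reach_leq j) => //; exact: IH (trB _ _ _ cx bx bc) ac le.
- by rewrite -cb; exact: (@reach_leq j).
Qed.

(** Iterates [reach_cross1] along the walk from [x] to [b], no vertex of which is earlier than [b].
    This makes reachable sets behave like the cliques [B x]. *)
Lemma reach_cross i j x b a :
  b \in reach B i x -> a \in reach B j x -> rk a <= rk b -> a \in reach B j b.
Proof.
elim: i x => [|i IH] x; first by rewrite inE => /eqP->.
case/reachSP=> [->//|[c cx bc]] ax le.
apply: (IH c) => //; apply: reach_cross1 cx ax _.
exact: leq_trans le (reach_rk bc).
Qed.

(* If [top] is the lowest element of [B x], a path from [x] to an element above
   [top] only meets bags containing [top]: removing [top] from them lowers the
   width by one. *)
Definition trim (top : H) y : {set H} :=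
  if top \in B y then [set b in B y | rk top < rk b] else set0.

Lemma trimP top y b : b \in trim top y ->
  [/\ top \in B y, b \in B y & rk top < rk b].
Proof.
by rewrite /trim; case: ifP => [ty|_]; rewrite inE // => /andP[bY tb]; split.
Qed.

Lemma mem_trim top y b :
  top \in B y -> b \in B y -> rk top < rk b -> b \in trim top y.
Proof. by rewrite /trim => -> ? ?; rewrite inE; apply/andP. Qed.

Lemma elim_order_trim top : elim_order rk (trim top).
Proof.
case: eB => injrk ltB trB; split=> // [y b /trimP[_ /ltB]//|y b c].
move=> /trimP[ty bY tb] /trimP[_ cY tc] cb.
by apply: mem_trim => //; [exact: (trB _ _ _ bY ty tb)|exact: (trB _ _ _ bY cY cb)].
Qed.

Lemma card_trim top y t : #|B y| <= t.+1 -> #|trim top y| <= t.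
Proof.
rewrite /trim; case: ifP => [ty le|_ _]; last by rewrite cards0.
rewrite -ltnS; apply: leq_trans le; apply: proper_card.
apply/properP; split; first by apply/subsetP=> b; rewrite inE => /andP[].
by exists top; rewrite // inE ltnn andbF.
Qed.

Lemma reach_trim top n y a :
  top \in B y -> a \in reach B n y -> rk top < rk a ->
  a \in reach (trim top) n y.
Proof.
case: eB => _ _ trB; elim: n y => [//|n IH] y ty.
case/reachSP=> [->|[b bY ab]] ta; first by rewrite /= !inE eqxx.
have tb := leq_trans ta (reach_rk ab).
rewrite /= inE; apply/orP; right; apply/bigcupP.
exists b; first exact: mem_trim.
by apply: IH => //; exact: (trB _ _ _ bY ty tb).
Qed.

End Reach.

(** Pascal's rule. With [top] the earliest element of [B x], the elements not later than [top] are
    reached from [top] with one step fewer; the later ones are reached inside the trimmed bags,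
    which have one element fewer. *)
Lemma card_reach (H : finType) (rk : H -> nat) (B : H -> {set H}) t k x :
  elim_order rk B -> (forall y, #|B y| <= t) -> #|reach B k x| <= 'C(k + t, t).
Proof.
elim: t B k x => [|t IHt] B k x eB cB.
  rewrite bin0 -(cards1 x); apply/subset_leq_card/subsetP => a.
  case: k => [//|k] /reachSP[->|[b]]; first by rewrite inE.
  by have := cB x; rewrite leqn0 cards_eq0 => /eqP->; rewrite in_set0.
elim: k x => [|k IHk] x; first by rewrite cards1 binn.
have [B0|[b0 b0x]] := set_0Vmem (B x).
  by rewrite /= B0 big_set0 setU0 cards1 bin_gt0 leq_addl.
case: (arg_minnP rk b0x) => top topx top_min.
rewrite addSn binS [in X in _ <= _ + X]addnS -[in X in _ <= _ + X]addSn.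
apply: leq_trans (leq_add (IHk top) (IHt _ k.+1 x (elim_order_trim eB top) _));
  last by move=> y; exact: card_trim.
apply: leq_trans (leq_card_setU _ _); apply/subset_leq_card/subsetP => a ax.
rewrite inE; apply/orP; case: (leqP (rk a) (rk top)) => [at_|ta]; last first.
  by right; exact: reach_trim.
left; case: (eB) => injrk ltB trB; move/reachSP: ax => [ea|[c cx ac]].
  by have := ltB _ _ topx; rewrite -ea ltnNge at_.
(* By minimality [c] is [top] or has [top] in [B c], so the step from [x] to [c] is saved. *)
have := top_min _ cx; rewrite leq_eqVlt => /orP[/eqP/injrk->//|tc].
exact: (reach_cross1 eB (trB _ _ _ cx topx tc) ac at_).
Qed.

Lemma elim_order_reach (H : finType) (rk : H -> nat) (B : H -> {set H}) k :
  elim_order rk B -> elim_order rk (fun x => reach B k x :\ x).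
Proof.
move=> eB; case: (eB) => injrk _ _; split=> // [y b|y b c].
  rewrite !inE => /andP[neq /(reach_rk eB)]; rewrite leq_eqVlt.
  by case/orP=> // /eqP/injrk eby; rewrite eby eqxx in neq.
rewrite !inE => /andP[_ bY] /andP[_ cY] cb.
rewrite (reach_cross eB bY cY (ltnW cb)) andbT.
by apply: contraTneq cb => ->; rewrite ltnn.
Qed.

(** * From an elimination order to a tree decomposition *)

Section ParentTree.
Variables (H : finType) (rk : H -> nat) (B : H -> {set H}).
Hypothesis eB : elim_order rk B.

(** The parent is the latest element of [B x]. [None] stands for an added root with empty bag, which
    joins the resulting forest into a nonempty tree. *)
Definition parent (x : H) : option H :=
  if [pick b in B x] is Some b then Some [arg max_(c > b in B x) rk c] else None.

Lemma parent_some x p : parent x = Some p ->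
  p \in B x /\ forall c, c \in B x -> rk c <= rk p.
Proof.
rewrite /parent; case: pickP => // b bx [<-].
by case: arg_maxnP.
Qed.

Lemma parent_none x : parent x = None -> B x = set0.
Proof.
rewrite /parent; case: pickP => // B0 _.
by apply/setP=> b; rewrite B0 inE.
Qed.

Definition child_rel : rel (option H) :=
  fun a b => if a is Some x then parent x == b else false.

Definition parent_rel : rel (option H) :=
  fun a b => child_rel a b || child_rel b a.

Definition bag (a : option H) : {set H} := if a is Some x then x |: B x else set0.

Lemma parent_relC : symmetric parent_rel.
Proof. by move=> a b; rewrite /parent_rel orbC. Qed.

Lemma child_rel_rk x y : child_rel (Some x) (Some y) -> rk y < rk x.
Proof.
by move=> /eqP/parent_some[yx _]; case: eB => _ ltB _; exact: ltB.
Qed.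

Lemma child_rel_asym a b : child_rel a b -> ~~ child_rel b a.
Proof.
case: a b => [x|] [y|] // /child_rel_rk yx; apply/negP=> /child_rel_rk xy.
by have := ltn_trans yx xy; rewrite ltnn.
Qed.

Lemma child_rel_irr a : child_rel a a = false.
Proof. by apply/negP=> aa; have := child_rel_asym aa; rewrite aa. Qed.

Lemma connect_root a : connect parent_rel a None.
Proof.
case: a => // x; have [m le_m] := ubnP (rk x).
elim: m x le_m => // m IH x le_m.
case ep: (parent x) => [p|].
  have px : child_rel (Some x) (Some p) by rewrite /= ep.
  apply: (@connect_trans _ _ (Some p)).
    by apply: connect1; rewrite /parent_rel px.
  by apply: IH; apply: leq_trans (child_rel_rk px) _.
by apply: connect1; rewrite /parent_rel /= ep eqxx.
Qed.

Lemma is_tree_parent : is_tree parent_rel.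
Proof.
split; first exact: parent_relC.
- by move=> a; rewrite /parent_rel child_rel_irr.
- by rewrite card_option.
- move=> a b; apply: (connect_trans (connect_root a)).
  by rewrite (sym_connect_sym parent_relC) connect_root.
(* The edges are the pairs [up x] and their reversals [dn x], all distinct: 2|H| ordered pairs on
   |H| + 1 nodes. *)
pose up x := (Some x, parent x); pose dn x := (parent x, Some x).
have ->: [set p | parent_rel p.1 p.2] = (up @: setT) :|: (dn @: setT).
  apply/setP=> -[a b]; rewrite !inE /=; congr (_ || _).
    apply/idP/imsetP=> [|[x _ [-> ->]]]; last by rewrite /= eqxx.
    by case: a => //= x /eqP <-; exists x.
  apply/idP/imsetP=> [|[x _ [-> ->]]]; last by rewrite /= eqxx.
  by case: b => //= x /eqP <-; exists x.
rewrite cardsU (_ : _ :&: _ = set0) ?cards0.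
  rewrite !card_imset ?cardsT; first by rewrite card_option; lia.
    by move=> x y [].
  by move=> x y [].
apply/setP=> -[a b]; rewrite !inE; apply/negP=> /andP[].
case/imsetP=> x _ [-> ->] /imsetP[y _ [e1 e2]].
have xy : child_rel (Some x) (Some y) by rewrite /= e2.
by have := child_rel_asym xy; rewrite /= e1 eqxx.
Qed.

(** Climb from [y] to its parent [p], the latest element of [B y]: either [v = p], or [v] is earlier
    and the clique condition puts it in [B p]. The climb ends at the node of [v]. *)
Lemma bag_connect v y : v \in bag (Some y) ->
  connect [rel a b | [&& parent_rel a b, v \in bag a & v \in bag b]]
    (Some y) (Some v).
Proof.
have [m le_m] := ubnP (rk y); elim: m y le_m => // m IH y le_m vy.
have [->//|neq] := eqVneq v y.
have vB : v \in B y by move: vy; rewrite /= !inE (negPf neq).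
case ep: (parent y) => [p|]; last by rewrite (parent_none ep) inE in vB.
have [pB pmax] := parent_some ep.
have py : child_rel (Some y) (Some p) by rewrite /= ep.
have vp : v \in bag (Some p).
  rewrite /= !inE; have := pmax _ vB; case: eB => injrk ltB trB.
  rewrite leq_eqVlt => /orP[/eqP/injrk->|vp]; first by rewrite eqxx.
  by rewrite (trB _ _ _ pB vB vp) orbT.
apply: (@connect_trans _ _ (Some p)).
  by apply: connect1; apply/and3P; rewrite /parent_rel py.
by apply: IH => //; apply: leq_trans (child_rel_rk py) _.
Qed.

Lemma elim_order_treewidth (g : rel H) w :
  (forall x, #|B x| <= w) ->
  (forall u v, g u v -> (u \in B v) || (v \in B u)) -> treewidth_le g w.
Proof.
move=> cB gB; exists (option H), parent_rel, bag; split.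
- exact: is_tree_parent.
- by move=> v; exists (Some v); rewrite /= !inE eqxx.
- move=> u v /gB/orP[uv|vu]; [exists (Some v)|exists (Some u)];
    by rewrite /= !inE eqxx ?uv ?vu ?orbT.
- move=> v a b va vb; set conn := connect _.
  have to_v c : v \in bag c -> conn c (Some v).
    by case: c => [x|]; [exact: bag_connect|rewrite in_set0].
  apply: (connect_trans (to_v a va)); rewrite sym_connect_sym; first exact: to_v.
  by move=> x y /=; rewrite parent_relC andbA andbAC -andbA.
case=> [x|]; rewrite ?cards0 //=.
apply: leq_trans (leq_card_setU _ _) _.
by rewrite cards1 add1n ltnS.
Qed.

End ParentTree.

(** * From a tree decomposition to an elimination order *)

Section RootedTree.
Variables (T : finType) (e : rel T).
Hypothesis eT : is_tree e.

(* Breadth-first search from [r] gives each other node a parent one step closer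
   to [r]; these |T| - 1 parent edges exhaust the edges of the tree. *)
Lemma tree_parent : exists (r : T) (dep : T -> nat) (par : T -> T),
  (forall x, x != r -> dep (par x) < dep x) /\
  forall x y, e x y -> (x != r) && (y == par x) || (y != r) && (x == par y).
Proof.
case: eT => esym eirr /card_gt0P[r _] econ ecard.
pose reaches x n := [exists p : n.-tuple T, path e x p && (last x p == r)].
have ex_reach x : exists n, reaches x n.
  have /connectP[p pp lp] := econ x r.
  exists (size p); apply/existsP; exists (in_tuple p).
  by rewrite pp -lp eqxx.
pose dep x := ex_minn (ex_reach x).
have near x : x != r -> exists y, e x y && (dep y < dep x).
  move=> xr; rewrite {2}/dep; case: ex_minnP => n /existsP[[p sp] /= /andP[pp lp]] _.
  case: p sp pp lp => [|y p] /= sp; first by rewrite (negPf xr).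
  case/andP=> exy pp lp; exists y; rewrite exy /=.
  rewrite /dep; case: ex_minnP => m _ min_m.
  have sz: size p = n.-1 by rewrite -(eqP sp).
  have : m <= n.-1.
    apply: min_m; rewrite -sz; apply/existsP; exists (in_tuple p).
    by rewrite pp lp.
  by rewrite -(eqP sp).
pose par x := odflt x [pick y | e x y && (dep y < dep x)].
have parP x : x != r -> e x (par x) && (dep (par x) < dep x).
  move=> /near[y Hy]; rewrite /par; case: pickP => [z //|/(_ y)].
  by rewrite Hy.
exists r, dep, par; split=> [x /parP/andP[]//|].
pose R := [set x | x != r].
pose up := [set (x, par x) | x in R]; pose dn := [set (par x, x) | x in R].
have cR : #|R| = #|T| - 1.
  by rewrite subn1 -(cardC1 r) cardsE; apply: eq_card => x; rewrite !inE.
have sub : up :|: dn \subset [set p : T * T | e p.1 p.2].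
  apply/subsetP=> -[a b]; rewrite !inE => /orP[] /imsetP[x]; rewrite inE.
    by move=> /parP/andP[ex _] [-> ->].
  by move=> /parP/andP[ex _] [-> ->]; rewrite /= esym.
have dis : up :&: dn = set0.
  apply/setP=> -[a b]; rewrite !inE; apply/negP=> /andP[/imsetP[x]].
  rewrite inE => /parP/andP[_ dx] [-> ->] /imsetP[y].
  rewrite inE => /parP/andP[_ dy] [e1 e2].
  by move: dx dy; rewrite -e1 -{}e2; lia.
have eqE : up :|: dn = [set p : T * T | e p.1 p.2].
  apply/eqP; rewrite eqEcard sub ecard cardsU dis cards0 !card_imset ?cR; first lia.
    by move=> x y [].
  by move=> x y [].
move=> x y exy.
have : (x, y) \in [set p : T * T | e p.1 p.2] by rewrite inE.
rewrite -eqE inE => /orP[] /imsetP[z]; rewrite inE => zr [-> ->];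
  by rewrite zr eqxx ?orbT.
Qed.

End RootedTree.

Section TopBags.
Variables (T : finType) (e : rel T) (V : finType) (B : T -> {set V}).
Variables (r : T) (dep : T -> nat) (par : T -> T).
Hypotheses (par_dep : forall x, x != r -> dep (par x) < dep x)
  (par_edge : forall x y, e x y ->
     (x != r) && (y == par x) || (y != r) && (x == par y))
  (B_conn : forall v x y, v \in B x -> v \in B y ->
          connect [rel a b | [&& e a b, v \in B a & v \in B b]] x y).

(* A walk from [y] to a node of no greater depth has to leave the subtree below
   [y], which it can only do along the edge from [y] to its parent. *)
Lemma bag_parent v x y : v \in B x -> v \in B y -> x != y -> dep x <= dep y ->
  (y != r) && (v \in B (par y)).
Proof.
move=> vx vy xy le_xy; have /connectP[p pp lp] := B_conn vy vx.
(* The subtree under [y]. The climb must not pass [r] before [y], since nothing is known about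
   [par r]. *)
pose below z := exists i, iter i par z = y /\ forall j, j < i -> iter j par z != r.
have below_dep z : below z -> z != y -> dep y < dep z.
  case=> i [<-]; elim: i z => [|i IH] z nr; first by rewrite eqxx.
  have zr := nr 0 isT; rewrite iterSr => _.
  have := par_dep zr; have [<-//|pz lt] := eqVneq (par z) (iter i par (par z)).
  apply: ltn_trans lt; apply: IH => // j ji.
  by rewrite -iterSr; apply: nr.
have nbx : ~ below x.
  by move=> /below_dep/(_ xy); rewrite ltnNge le_xy.
have by_ : below y by exists 0.
suff walk z : below z -> v \in B z ->
    path [rel a b | [&& e a b, v \in B a & v \in B b]] z p -> last z p = x ->
    (y != r) && (v \in B (par y)) by exact: walk by_ vy pp (esym lp).
elim: p z {pp lp} => [|w p IH] z bz vz /=; first by move=> _ ex; rewrite ex in bz.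
case/andP=> /and3P[ezw _ vw] pp lp.
case/orP: (par_edge ezw) => /andP[nr /eqP ew].
  have [zy|zy] := eqVneq z y; first by rewrite -zy nr -ew.
  apply: (IH w) => //; case: bz => -[|i] [iz inr].
    by rewrite /= in iz; rewrite iz eqxx in zy.
  exists i; rewrite ew -iterSr; split=> // j ji.
  by rewrite -iterSr; apply: inr.
apply: (IH w) => //; case: bz => i [iz inr]; exists i.+1.
rewrite iterSr -ew; split=> // -[|j] ji //.
by rewrite iterSr -ew; apply: inr.
Qed.

Hypothesis B_cov : forall v, exists x, v \in B x.

(** [top v] is a node of least depth among those whose bag contains [v]. Climbing from [y] to
    [top b] keeps both [b] and [c] in the bag, by [bag_parent]. *)
Lemma top_bag : exists top : V -> T,
  (forall v, v \in B (top v)) /\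
  forall b c y, b \in B y -> c \in B y -> dep (top c) <= dep (top b) ->
    c \in B (top b).
Proof.
have top_ex v : exists x, (v \in B x) && [forall y, (v \in B y) ==> (dep x <= dep y)].
  have [x0 x0v] := B_cov v.
  case: (@arg_minnP _ x0 (fun x => v \in B x) dep x0v) => x vx min_x.
  by exists x; rewrite vx; apply/forallP=> y; apply/implyP; exact: min_x.
pose top v := xchoose (top_ex v).
have topB v : v \in B (top v) by have /andP[] := xchooseP (top_ex v).
have topm v y : v \in B y -> dep (top v) <= dep y.
  by move=> vy; have /andP[_ /forallP/(_ y)/implyP->] := xchooseP (top_ex v).
exists top; split=> // b c y.
have [m le_m] := ubnP (dep y); elim: m y le_m => // m IH y le_m bY cY le.
have [->//|neq] := eqVneq (top b) y.
have /andP[yr bp] := bag_parent (topB b) bY neq (topm _ _ bY).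
have lt := par_dep yr.
(* Otherwise [top b], no deeper than [par y], would be strictly shallower than [top c]. *)
have ncy : top c != y.
  apply/eqP=> ecy; have := topm _ _ bp; rewrite -ecy in lt.
  by move: le; rewrite {1}ecy; move: lt; rewrite ecy; lia.
have /andP[_ cp] := bag_parent (topB c) cY ncy (topm _ _ cY).
by apply: (IH (par y)) => //; lia.
Qed.

End TopBags.

(** Order the vertices by the depth of their top bag and let [B v] be the earlier vertices of the
    bag at [top v]. That bag also contains [v], so at most [w] of its [w.+1] elements remain. *)
Lemma treewidth_elim_order (V : finType) (g : rel V) w : treewidth_le g w ->
  exists (rk : V -> nat) (B : V -> {set V}),
    [/\ elim_order rk B, forall x, #|B x| <= w
      & forall u v, g u v -> [|| u == v, u \in B v | v \in B u]].
Proof.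
case=> T [e [B [eT B_cov B_edge B_conn B_card]]].
have [r [dep [par [par_dep par_edge]]]] := tree_parent eT.
have [top [topB topc]] := top_bag par_dep par_edge B_conn B_cov.
(* Lexicographic: depth first, ties broken by [enum_rank], which is below [#|V|]. *)
pose rk v := dep (top v) * #|V| + enum_rank v.
have rk_dep u v : rk u <= rk v -> dep (top u) <= dep (top v).
  apply: contraTT; rewrite -!ltnNge => lt; rewrite /rk.
  apply: (@leq_trans ((dep (top v)).+1 * #|V|)).
    by rewrite mulSn addnC -addSn leq_add2r ltn_ord.
  exact: leq_trans (leq_mul lt (leqnn _)) (leq_addr _ _).
have injrk : injective rk.
  move=> u v euv; apply: enum_rank_inj; apply: val_inj => /=.
  have ed : dep (top u) = dep (top v).
    by apply/eqP; rewrite eqn_leq !rk_dep ?euv.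
  by move: euv; rewrite /rk ed; apply: addnI.
exists rk, (fun v => [set b in B (top v) | rk b < rk v]); split.
- split=> // [y b|y b c]; rewrite !inE => /andP[] //.
  by move=> bY _ /andP[cY _] cb; rewrite cb (topc _ _ _ bY cY) // rk_dep // ltnW.
- move=> v; rewrite -ltnS; apply: leq_trans (B_card (top v)); apply: proper_card.
  apply/properP; split; first by apply/subsetP=> b; rewrite inE => /andP[].
  by exists v; rewrite // inE ltnn andbF.
move=> u v /B_edge[x /andP[ux vx]]; rewrite !inE.
case: (ltngtP (rk u) (rk v)) => [uv|vu|/injrk->]; last by rewrite eqxx.
  by rewrite (topc _ _ _ vx ux) ?orbT // rk_dep // ltnW.
by rewrite (topc _ _ _ ux vx) ?orbT // rk_dep // ltnW.
Qed.

(** * Walks along the paths of a shortcut system *)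

Definition walk (V : Type) (g : rel V) (w : nat -> V) (m : nat) : Prop :=
  forall i, i < m -> g (w i) (w i.+1).

Lemma walk_rev (V : Type) (g : rel V) w m : symmetric g ->
  walk g w m -> walk g (fun i => w (m - i)) m.
Proof.
move=> gS gw i im; rewrite gS (_ : m - i = (m - i.+1).+1); last lia.
by apply: gw; lia.
Qed.

Lemma walk_lip (V : Type) (g : rel V) (Y : V -> nat) w m : symmetric g ->
  (forall u v, g u v -> Y u <= (Y v).+1) -> walk g w m ->
  (Y (w 0) <= Y (w m) + m) /\ (Y (w m) <= Y (w 0) + m).
Proof.
move=> gS gY; elim: m => [|m IH] gw; first by rewrite addn0.
have [] := IH (fun i im => gw i (ltnW im)).
have gm := gw m (ltnSn m).
have := gY _ _ gm; rewrite gS in gm; have := gY _ _ gm; lia.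
Qed.

Section Paths.
Variables (V : finType) (g : rel V).
Hypothesis gS : symmetric g.

Lemma internalP (p : seq V) v :
  reflect (exists2 j, 0 < j < (size p).-1 & nth v p j = v) (internal p v).
Proof.
have sz : size (drop 1 (take (size p).-1 p)) = (size p).-1.-1.
  by rewrite size_drop size_take; case: ifP; lia.
apply: (iffP (nthP v)); rewrite sz => -[j jp].
  by rewrite nth_drop nth_take => [ej|]; [exists (1 + j) => //; lia|lia].
move=> ej; exists j.-1; first lia.
by rewrite nth_drop nth_take; [rewrite (_ : 1 + j.-1 = j) //; lia|lia].
Qed.

Lemma nth_internal (p : seq V) x j : 0 < j < (size p).-1 -> internal p (nth x p j).
Proof. by move=> jp; apply/internalP; exists j => //; apply: set_nth_default; lia. Qed.

(** Follow [p] from [w] towards [v], forwards or backwards. As [w] is internal, at least one edge of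
    [p] is left out, and only the last vertex can be an end of [p]. *)
Lemma gpath_walk (p : seq V) w v : is_gpath g p -> internal p w -> v \in p ->
  exists (q : nat -> V) (m : nat), [/\ q 0 = w, q m = v, m <= (size p).-2,
    walk g q m & forall i, i < m -> internal p (q i)].
Proof.
case=> _ _ gp /internalP[j jp ej] /(nthP w)[i].
rewrite -[size _]/(size p) => ip ei.
have [ij|ji] := leqP i j.
  exists (fun s => nth w p (j - s)), (j - i); rewrite subn0 subKn //; split=> //.
  - lia.
  - move=> s sm; rewrite gS (_ : j - s = (j - s.+1).+1); last lia.
    by apply: gp; lia.
  - by move=> s sm; apply: nth_internal; lia.
exists (fun s => nth w p (j + s)), (i - j).
rewrite addn0 (subnKC (ltnW ji)); split=> //.
- lia.
- by move=> s sm; rewrite addnS; apply: gp; lia.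
- by move=> s sm; apply: nth_internal; lia.
Qed.

(** An edge of [g] is a walk of length 1 with no inner vertex; a shortcut gives its path, reversed
    if necessary. *)
Lemma augment_walk P k u v :
  0 < k -> (forall p : seq V, p \in P -> is_gpath g p /\ 1 <= (size p).-1 <= k) ->
  augment g P u v ->
  exists (q : nat -> V) (m : nat), [/\ q 0 = u, q m = v, 0 < m <= k, walk g q m
    & forall i, 0 < i < m ->
        exists2 p, p \in P & [/\ u \in p, v \in p & internal p (q i)]].
Proof.
move=> k0 PP /orP[guv|/andP[_ /hasP[p pP hp]]].
  exists (fun i => if i is 0 then u else v), 1; split=> //.
  - by case.
  - by case=> [|[|]].
have [[p0 _ gp] sp] := PP p pP.
pose q i := nth u p i; pose m := (@size V p).-1.
have gq : walk g q m by move=> i im; apply: gp; rewrite /m in im; lia.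
have q0 : q 0 = head u p by rewrite /q nth0.
have qm : q m = last u p by rewrite /q nth_last.
have inp i : i <= m -> q i \in p by move=> im; apply: mem_nth; rewrite -[size _]/(@size V p) -(prednK p0).
have iq i : 0 < i < m -> internal p (q i) by exact: nth_internal.
case/orP: hp => /andP[/eqP hu /eqP hv].
  exists q, m; rewrite q0 qm; split=> // i im; exists p => //.
  by rewrite -{1}hu -{1}hv -q0 -qm; split; auto.
exists (fun i => q (m - i)), m; rewrite subn0 subnn q0 qm; split=> //.
  exact: walk_rev.
move=> i im; exists p => //.
rewrite -{1}hu -{1}hv -q0 -qm; split; auto.
by apply: iq; lia.
Qed.

End Paths.

(** * Apexes and their adjacency *)

Section Shortcuts.
Variables (V H : finType) (g : rel V) (P : seq (seq V)) (k : nat).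
Variables (rk : H -> nat) (B : H -> {set H}) (X : V -> H) (Y : V -> nat).
Hypotheses (gS : symmetric g) (k_gt0 : 0 < k) (eB : elim_order rk B).
Hypothesis PP : forall p : seq V, p \in P -> is_gpath g p /\ 1 <= (size p).-1 <= k.
Hypothesis gX : forall u v, g u v ->
  [|| X u == X v, X u \in B (X v) | X v \in B (X u)].
Hypothesis gY : forall u v, g u v -> Y u <= (Y v).+1.

(** If [X u \in B (X v)], this is the extra step. If [X v \in B (X u)], [reach_cross1] applies
    without extra step, as [a] is not later than [X v]. *)
Lemma reach_edge u v j a : g u v -> a \in reach B j (X u) -> rk a <= rk (X v) ->
  a \in reach B j.+1 (X v).
Proof.
move=> /gX/or3P[/eqP->|uv|vu] au le.
- exact: reach_leq au.
- exact: reachS uv au.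
- by apply: (@reach_leq _ _ j) => //; exact: (reach_cross1 eB vu au).
Qed.

Lemma reach_walk q m j a : walk g q m -> a \in reach B j (X (q 0)) ->
  (forall i, i <= m -> rk a <= rk (X (q i))) -> a \in reach B (j + m) (X (q m)).
Proof.
elim: m => [|m IH] gq a0 le; first by rewrite addn0.
rewrite addnS; apply: (@reach_edge (q m)); [exact: gq|idtac|exact: le].
by apply: IH => // i im; [apply: gq|apply: le]; exact: ltnW.
Qed.

Definition seen v w := (w == v) || has (fun p => (v \in p) && internal p w) P.

(** [X (apex v)] is the vertex [a v] of the overview. Choosing a vertex of [V] allows [v] to be
    charged to a path having [apex v] as internal vertex. *)
Definition apex v : V := [arg min_(w < v | seen v w) rk (X w)].

Lemma apexP v : seen v (apex v) /\
  forall w, seen v w -> rk (X (apex v)) <= rk (X w).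
Proof. by rewrite /apex; case: arg_minnP => //; rewrite /seen eqxx. Qed.

Lemma seen_walk v w : seen v w ->
  exists (q : nat -> V) (m : nat), [/\ q 0 = w, q m = v, m <= k.-1, walk g q m
    & forall i, i <= m -> seen v (q i)].
Proof.
case/orP=> [/eqP->|/hasP[p pP /andP[vp wp]]].
  by exists (fun=> v), 0; split=> // i _; rewrite /seen eqxx.
have [gp sp] := PP pP; have [q [m [q0 qm mp gq iq]]] := gpath_walk gS gp wp vp.
exists q, m; split=> //; first lia.
move=> i; rewrite leq_eqVlt => /orP[/eqP->|im]; first by rewrite qm /seen eqxx.
by apply/orP; right; apply/hasP; exists p; rewrite // vp iq.
Qed.

(** All vertices of the walk from [apex v] to [v] are seen from [v], so none projects earlier than
    the apex and [reach_walk] applies. *)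
Lemma reach_apex v : X (apex v) \in reach B k.-1 (X v).
Proof.
have [sv mv] := apexP v; have [q [m [q0 qm mk gq sq]]] := seen_walk sv.
apply: (reach_leq mk); rewrite -[in X v]qm -[m]add0n; apply: reach_walk => //.
  by rewrite q0 reach_refl.
by move=> i /sq/mv.
Qed.

Lemma seen_lip v w : seen v w -> Y v <= Y w + k.-1 /\ Y w <= Y v + k.-1.
Proof.
case/seen_walk=> q [m [q0 qm mk gq _]].
have := walk_lip gS gY gq; rewrite q0 qm; lia.
Qed.

Lemma augment_lip u v : augment g P u v -> Y u <= Y v + k /\ Y v <= Y u + k.
Proof.
case/(augment_walk gS k_gt0 PP)=> q [m [q0 qm mk gq _]].
have := walk_lip gS gY gq; rewrite q0 qm; lia.
Qed.

(* The neighbour of [v] on the path from [u] has the apex of [u] above it, so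
   one of the two is a common descendant of both apexes at distance at most [k]
   from that of [v]. *)
Lemma apex_walk u v q m : q 0 = u -> q m = v -> 0 < m -> walk g q m ->
  (forall i, 0 < i < m -> seen u (q i)) ->
  rk (X (apex v)) <= rk (X (apex u)) ->
  X (apex v) \in reach B k (X (apex u)).
Proof.
case: m => // m q0 qm _ gq su le.
have au : X (apex u) \in reach B (k.-1 + m) (X (q m)).
  apply: reach_walk => [i im||i im].
  - by apply: gq; exact: ltnW.
  - by rewrite q0; exact: reach_apex.
  have [su0 mu] := apexP u; apply: mu; case: i im => [|i] im.
    by rewrite q0 /seen eqxx.
  by apply: su; lia.
have av := reach_apex v; have leS x : x \in reach B k.-1 (X v) -> x \in reach B k (X v).
  by apply: reach_leq; exact: leq_pred.
(* Both apexes are reached from [X v] in the first two cases, from [X (q m)] in the third. There the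
   apex of [v] costs one step more than [k.-1]. *)
have := gX (gq m (ltnSn m)); rewrite qm => /or3P[/eqP e|qv|vq].
- by apply: (reach_cross eB au _ le); rewrite e; exact: leS.
- exact: (reach_cross eB (reachS qv au) (leS _ av) le).
- apply: (reach_cross eB au _ le); rewrite -(prednK k_gt0).
  exact: reachS vq av.
Qed.

Lemma augment_apex u v : augment g P u v ->
  (X (apex u) \in reach B k (X (apex v))) || (X (apex v) \in reach B k (X (apex u))).
Proof.
case/(augment_walk gS k_gt0 PP)=> q [m [q0 qm /andP[m0 mk] gq iq]].
have [le|/ltnW le] := leqP (rk (X (apex v))) (rk (X (apex u))).
  apply/orP; right; apply: apex_walk q0 qm m0 gq _ le => i im.
  have [p pP [up _ qp]] := iq i im.
  by apply/orP; right; apply/hasP; exists p; rewrite // up.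
apply/orP; left; apply: apex_walk (walk_rev gS gq) _ le; rewrite ?subn0 ?subnn //.
move=> i im; have [|p pP [_ vp qp]] := iq (m - i); first lia.
by apply/orP; right; apply/hasP; exists p; rewrite // vp.
Qed.

(** * Counting the vertices with the same image *)

Variables (l d : nat) (Z : V -> 'I_l).
Hypothesis d_gt0 : 0 < d.
Hypothesis XYZ_inj : injective (fun v => (X v, Y v, Z v)).
Hypothesis Pd : forall v, count (fun p => internal p v) P <= d.

(** Over [a], each of the [L] layers has at most [l] vertices, by [XYZ_inj]. The shift [s] lets the
    window start below layer 0 without truncated subtraction. *)
Lemma card_column a s lo L :
  #|[set w | (X w == a) && (lo <= Y w + s < lo + L)]| <= L * l.
Proof.
case: L => [|L].
  rewrite leqn0 cards_eq0; apply/eqP/setP=> w; rewrite !inE; lia.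
pose F w : 'I_L.+1 * 'I_l := (inord (Y w + s - lo), Z w).
rewrite -[X in _ <= X * _]card_ord -(card_ord l) -card_prod.
rewrite -(@card_in_imset _ _ F); first exact: max_card.
move=> u v; rewrite !inE => /and3P[/eqP Xu lou upu] /and3P[/eqP Xv lov upv].
case=> /(congr1 val) /=; rewrite !inordK; try lia.
move=> eY eZ; apply: XYZ_inj; congr (_, _, _) => //; first by rewrite Xu.
lia.
Qed.

Lemma card_fiber a c :
  #|[set v | (X (apex v) == a) && (Y v %/ k == c)]| <= d * l * (k ^ 3 + 3 * k).
Proof.
(* [W0] receives the vertices that are their own apex. The other apexes lie at most [k - 1] layers
   outside the block on either side, so [W] spans k + 2(k - 1) = 3k - 2 layers. *)
pose W0 := [set w | (X w == a) && (c * k <= Y w + 0 < c * k + k)].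
pose W := [set w | (X w == a) && (c * k <= Y w + k.-1 < c * k + (3 * k - 2))].
pose N w := \bigcup_(p <- P | internal p w) [set v in p].
have sub : [set v | (X (apex v) == a) && (Y v %/ k == c)] \subset
    W0 :|: \bigcup_(w in W) N w.
  apply/subsetP=> v; rewrite !inE => /andP[/eqP Xa /eqP Yc].
  have dv := divn_eq (Y v) k; have mv := ltn_pmod (Y v) k_gt0; rewrite Yc in dv.
  have [sv _] := apexP v; have [lip1 lip2] := seen_lip sv.
  case/orP: sv => [/eqP ev|/hasP[p pP /andP[vp ap]]].
    by rewrite -{1}ev Xa eqxx /=; apply/orP; left; lia.
  apply/orP; right; apply/bigcupP; exists (apex v).
    by rewrite inE Xa eqxx /=; lia.
  by rewrite /N (big_rem p pP) /= ap !inE vp.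
have cN w : #|N w| <= d * k.+1.
  apply: (@leq_trans (\sum_(p <- P | internal p w) k.+1)).
    rewrite /N big_seq_cond [in X in _ <= X]big_seq_cond.
    apply: (big_ind2 (fun (A : {set V}) s => #|A| <= s)); first by rewrite cards0.
      move=> A1 s1 A2 s2 l1 l2.
      exact: leq_trans (leq_card_setU _ _) (leq_add l1 l2).
    move=> p /andP[pP _]; have [_ sp] := PP pP.
    by rewrite cardsE; apply: leq_trans (card_size p) _; lia.
  rewrite big_const_seq iter_addn_0 mulnC leq_mul2r; apply/orP; right; exact: Pd.
have cW : #|\bigcup_(w in W) N w| <= (3 * k - 2) * l * (d * k.+1).
  apply: (@leq_trans (\sum_(w in W) d * k.+1)).
    apply: (big_ind2 (fun (A : {set V}) s => #|A| <= s)); first by rewrite cards0.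
      move=> A1 s1 A2 s2 l1 l2.
      exact: leq_trans (leq_card_setU _ _) (leq_add l1 l2).
    by move=> w _; exact: cN.
  by rewrite sum_nat_const leq_mul2r card_column orbT.
apply: leq_trans (subset_leq_card sub) _.
apply: leq_trans (leq_card_setU _ _) _.
apply: leq_trans (leq_add (card_column _ _ _ _) cW) _.
have le1 : k * l <= d * l * k by rewrite mulnAC leq_mul2r mulnC leq_pmulr ?orbT.
apply: (@leq_trans (d * l * (k + (3 * k - 2) * k.+1))).
  by rewrite mulnDr leq_add // leq_eqVlt; apply/orP; left; apply/eqP; nia.
rewrite leq_mul2l; apply/orP; right.
(* The difference of the two sides is (k - 2)(k^2 - k - 1), which vanishes at k = 2 and is positive
   for all other k > 0. *)
case: (k) k_gt0 => [//|[|[|k']]] _ //; nia.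
Qed.

End Shortcuts.

(** * Assembling the embedding into the strong product *)

Lemma subgraph_strong_complete (V W : finType) (g : rel V) (x : rel W)
    (f : V -> W) m :
  irreflexive g -> (forall c, #|[set v | f v == c]| <= m) ->
  (forall u v, g u v -> (f u == f v) || x (f u) (f v)) ->
  subgraph g (strong x (complete m)).
Proof.
(* The coordinate of [v] in the complete graph is its position in the enumeration of its fibre. *)
move=> gI cf gx; pose fib v := enum [set w | f w == f v].
have inf v : v \in fib v by rewrite mem_enum inE.
have lt v : index v (fib v) < m.
  apply: leq_trans (cf (f v)).
  by rewrite [X in _ < X]cardE index_mem.
pose F v : W * 'I_m := (f v, Ordinal (lt v)).
have injF : injective F.
  move=> u v /pair_equal_spec[ef /(congr1 val) /= ei].
  rewrite -(nth_index u (inf u)) ei (_ : fib u = fib v) ?nth_index //.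
  by rewrite /fib ef.
exists F; split=> // u v guv; apply/and3P; split.
- by rewrite (inj_eq injF); apply: contraTneq guv => ->; rewrite gI.
- exact: gx.
- by rewrite /complete orbN.
Qed.

Theorem theorem4 (t l k d : nat) (V : finType) (g : rel V)
    (H : finType) (h : rel H) (n : nat) (P : seq (seq V)) :
  0 < t -> 0 < l -> 0 < k -> 0 < d ->
  symmetric g -> irreflexive g ->
  symmetric h -> irreflexive h -> treewidth_le h t ->
  0 < n ->
  subgraph g (strong (strong h (path_rel n)) (complete l)) ->
  shortcut_system g k d P ->
  exists (J : finType) (j : rel J) (n' : nat),
    [/\ symmetric j, irreflexive j, treewidth_le j ('C(k + t, t) - 1), 0 < n'
      & subgraph (augment g P)
          (strong (strong j (path_rel n')) (complete (d * l * (k ^ 3 + 3 * k))))].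
Proof.
move=> _ _ k0 d0 gS gI _ _ /treewidth_elim_order[rk [B [eB cB hB]]] n0.
move=> [f [f_inj gf]] [_ _ PP Pd].
pose X v := (f v).1.1; pose Y v : nat := (f v).1.2; pose Z v := (f v).2.
have gX u v : g u v -> [|| X u == X v, X u \in B (X v) | X v \in B (X u)].
  case/gf/and3P=> _ /orP[/eqP e _|/and3P[_ /orP[e _ _|/hB//]]].
    by rewrite /X e eqxx.
  by rewrite /X e.
have gY u v : g u v -> Y u <= (Y v).+1.
  case/gf/and3P=> _ /orP[/eqP e _|/and3P[_ _ /orP[/eqP e _|]]].
  - by rewrite /Y e.
  - by rewrite /Y e.
  - by rewrite /path_rel /Y => /orP[] /eqP; lia.
have XYZ_inj : injective (fun v => (X v, Y v, Z v)).
  move=> u v [eX eY eZ]; apply: f_inj; move: eX eY eZ; rewrite /X /Y /Z.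
  by case: (f u) (f v) => [[a b] c] [[a' b'] c'] /= -> /val_inj -> ->.
pose A v := X (apex P rk X v).
pose j : rel H := fun a b => (a != b) && ((a \in reach B k b) || (b \in reach B k a)).
(* Block numbers do not exceed layer numbers, so a path on [n] vertices suffices again. *)
have Yn v : Y v %/ k < n by apply: leq_ltn_trans (leq_div _ _) (ltn_ord _).
exists H, j, n; split=> //.
- by move=> a b; rewrite /j eq_sym orbC.
- by move=> a; rewrite /j eqxx.
(* Removing [x] from its own reachable set gives the -1 in the width. *)
- apply: (elim_order_treewidth (elim_order_reach k eB)) => [x|u v].
    have := card_reach k x eB cB; rewrite (cardsD1 x) reach_refl; lia.
  by rewrite !inE [v == u]eq_sym -andb_orr.
pose F v : H * 'I_n := (A v, Ordinal (Yn v)).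
apply: (@subgraph_strong_complete _ _ _ _ F).
- by move=> v; rewrite /augment gI eqxx.
- case=> a c; have := card_fiber rk gS k0 PP gY d0 XYZ_inj Pd a c.
  by apply: leq_trans; rewrite subset_leq_card //; apply/subsetP=> v; rewrite !inE.
move=> u v uv; rewrite /strong; have [//|neq /=] := eqVneq (F u) (F v).
apply/andP; split.
  rewrite /j; have [//|_ /=] := eqVneq (A u) (A v).
  exact: (augment_apex gS k0 eB PP gX).
have [le1 le2] := augment_lip gS k0 PP gY uv.
(* Layers at distance at most [k] lie in equal or consecutive blocks. *)
have sh x y : y <= x + k -> y %/ k <= (x %/ k).+1.
  move=> le; have := leq_div2r k le.
  by rewrite divnDr ?dvdnn // divnn k0 addn1.
have := sh _ _ le1; have := sh _ _ le2.
rewrite /path_rel -val_eqE /=; lia.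
Qed.
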